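(* Let $g:\mathbb{R}^n\to\mathbb{R}$ be convex and smooth (with Lipschitz continuous gradient), not necessarily strongly convex, and let $f(x)=\max_{(v,b)\in\mathcal V}\{v^\top x+b\}$ with $\mathcal V\subset\mathbb{R}^{n+1}$ finite and nonempty. Then MPB-FA with serious step test parameter $\epsilon/2$, run with the active-cut policy, finds an $\epsilon$-optimal solution of $\min_{x\in\mathbb{R}^n}\{g(x)+f(x)\}$ in at most $\mathcal{O}\big(\epsilon^{-8/9}(\log\epsilon^{-1})^{2/9}\big)$ iterations.
   Context: Write $h=g+f$; it is assumed that $\min_x h(x)$ has an optimal solution $x^*$. A point $x$ is $\epsilon$-optimal if $h(x)-h(x^* )\le\epsilon$. MPB-FA (Modified Proximal Bundle with Fixed Absolute Accuracy) with the active-cut policy: inputs $x_0\in\mathbb{R}^n$, nonempty $\mathcal V^0\subset\mathcal V$, $\epsilon>0$, and a constant proximal parameter $\rho>0$. For $k=0,1,2,\dots$: let $f_k(x)=\max_{(v,b)\in\mathcal V^k}\{v^\top x+b\}$; compute $y_{k+1}=\arg\min_{x}\{g(x)+f_k(x)+\frac{\rho}{2}\|x-x_k\|^2\}$; choose $(v_{k+1},b_{k+1})\in\arg\max_{(v,b)\in\mathcal V}\{v^\top y_{k+1}+b\}$; call a cut $(v,b)\in\mathcal V^k$ active at iteration $k$ if $f_k(y_{k+1})=v^\top y_{k+1}+b$; the new bundle $\mathcal V^{k+1}$ consists of the cuts of $\mathcal V^k$ active at iteration $k$ together with the new cut $(v_{k+1},b_{k+1})$ (this is done after both serious and null steps;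 inactive cuts are dropped); if $f(y_{k+1})-f_k(y_{k+1})\le\epsilon/2$ set $x_{k+1}=y_{k+1}$ (serious step), otherwise set $x_{k+1}=x_k$ (null step).
   Formalization: The proximal parameter ρ, constant during a run, is assumed to depend on ε with ρ = O((ε log²(1/ε))^{1/9}) as ε→0; for ρ fixed independently of ε the stated rate fails, e.g. n=1, f=0, g=|t|^20 near 0. *)

(* Defs.v *)
From HB Require Import structures.
From mathcomp Require Import all_boot all_order all_algebra.
From mathcomp Require Import all_classical all_reals all_analysis.

Set Implicit Arguments.
Unset Strict Implicit.
Unset Printing Implicit Defensive.

Import Order.TTheory GRing.Theory Num.Theory.
Import numFieldNormedType.Exports.

Local Open Scope classical_set_scope.
Local Open Scope ring_scope.

Definition dot (R : realType) (n : nat) (u v : 'rV[R]_n) : R :=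
  \sum_(i < n) u 0 i * v 0 i.

(* The library's norm `|u| on 'rV[R]_n is the sup norm. *)
Definition enorm (R : realType) (n : nat) (u : 'rV[R]_n) : R :=
  Num.sqrt (dot u u).

Definition grad (R : realType) (n : nat) (g : 'rV[R]_n -> R) (x : 'rV[R]_n) :
    'rV[R]_n :=
  \row_(i < n) 'D_(delta_mx 0 i) g x.

Definition smooth (R : realType) (n : nat) (g : 'rV[R]_n -> R) : Prop :=
  (forall x, differentiable g x) /\
  exists L : R, forall x y, enorm (grad g x - grad g y) <= L * enorm (x - y).

(* The pair (v, b) stands for the affine function x |-> v^T x + b. *)
Definition affine_cut (R : realType) (n : nat) : Type := ('rV[R]_n * R)%type.

Definition cutval (R : realType) (n : nat) (c : affine_cut R n)
    (x : 'rV[R]_n) : R :=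
  dot c.1 x + c.2.

(* The sup is a maximum when B is finite and nonempty, which is the only case
   in which it is used. *)
Definition maxcut (R : realType) (n : nat) (B : set (affine_cut R n))
    (x : 'rV[R]_n) : R :=
  sup [set cutval c x | c in B].

Definition composite (R : realType) (n : nat) (g : 'rV[R]_n -> R)
    (V : set (affine_cut R n)) (x : 'rV[R]_n) : R :=
  g x + maxcut V x.

Definition minimizer (R : realType) (n : nat) (F : 'rV[R]_n -> R)
    (x : 'rV[R]_n) : Prop :=
  forall z, F x <= F z.

Definition eps_optimal (R : realType) (n : nat) (F : 'rV[R]_n -> R)
    (xs : 'rV[R]_n) (eps : R) (x : 'rV[R]_n) : Prop :=
  F x - F xs <= eps.

Definition prox_model (R : realType) (n : nat) (g : 'rV[R]_n -> R)
    (B : set (affine_cut R n)) (rho : R) (x z : 'rV[R]_n) : R :=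
  g z + maxcut B z + rho / 2 * enorm (z - x) ^+ 2.

Definition active (R : realType) (n : nat) (B : set (affine_cut R n))
    (y : 'rV[R]_n) : set (affine_cut R n) :=
  [set c | B c /\ cutval c y = maxcut B y].

(* Sequences produced by the algorithm from x0 and V0: x k is x_k, B k is the
   bundle V^k, y k is y_k and c k is the cut (v_k, b_k); y 0 and c 0 carry no
   information.  The choice of c k.+1 among the maximizing cuts is left free. *)
Record MPBFA_run (R : realType) (n : nat) (g : 'rV[R]_n -> R)
    (V : set (affine_cut R n)) (rho eps : R) (x0 : 'rV[R]_n)
    (V0 : set (affine_cut R n)) (x y : nat -> 'rV[R]_n)
    (B : nat -> set (affine_cut R n)) (c : nat -> affine_cut R n) : Prop := {
  run_x0 : x 0%N = x0;
  run_B0 : B 0%N = V0;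
  run_y : forall k, minimizer (prox_model g (B k) rho (x k)) (y k.+1);
  run_c : forall k, V (c k.+1) /\
    forall d, V d -> cutval d (y k.+1) <= cutval (c k.+1) (y k.+1);
  run_B : forall k, B k.+1 = active (B k) (y k.+1) `|` [set c k.+1];
  run_serious : forall k,
    maxcut V (y k.+1) - maxcut (B k) (y k.+1) <= eps / 2 ->
    x k.+1 = y k.+1;
  run_null : forall k,
    eps / 2 < maxcut V (y k.+1) - maxcut (B k) (y k.+1) ->
    x k.+1 = x k
}.

Definition rate (R : realType) (eps : R) : R :=
  eps `^ (- (8 / 9)) * ln eps^-1 `^ (2 / 9).

(* The proximal parameter is constant along a run but is tuned to the target
   accuracy: rho is a function of eps of order at most
   eps * rate eps = (eps * ln(1/eps)^2)^(1/9).  For a rho that does not depend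
   on eps the rate fails: with V = {(0, 0)} and n = 1, every step is a serious
   exact proximal step, and if g is |t|^20 near 0 the method started near 0
   takes about eps^(-9/10) iterations. *)
Definition prox_scale (R : realType) (eps : R) : R :=
  (eps * ln eps^-1 ^+ 2) `^ (1 / 9).

(* Main.v *)
(* A serious step that does not reach an eps-optimal point brings the iterate
   closer to xs: strong convexity of the proximal model and the eps / 2 test give
     |xs - x_(k+1)|^2 + eps / rho <= |xs - x_k|^2,
   so at most rho |xs - x0|^2 / eps serious steps miss the target, which is
   O(rate eps) because prox_scale eps = eps * rate eps.
   Between two serious steps the minimum of the proximal model strictly
   increases; it is determined by the bundle, a subset of V, so a streak of null
   steps has length at most 2^|V|, a bound independent of eps. *)

Require Import Defs.
From HB Require Import structures.
From mathcomp Require Import all_boot all_order all_algebra.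
From mathcomp Require Import all_classical all_reals all_analysis.
From mathcomp Require Import ring lra.

Set Implicit Arguments.
Unset Strict Implicit.
Unset Printing Implicit Defensive.

Import Order.TTheory GRing.Theory Num.Theory.
Import numFieldNormedType.Exports.

Local Open Scope classical_set_scope.
Local Open Scope ring_scope.

(** * Convexity along segments and the Euclidean norm *)

Definition segpt (R : realType) (n : nat) (y z : 'rV[R]_n) (t : R) : 'rV[R]_n :=
  (1 - t) *: y + t *: z.

Lemma sqr_enormE (R : realType) (n : nat) (u : 'rV[R]_n) :
  enorm u ^+ 2 = \sum_(i < n) u 0 i ^+ 2.
Proof.
rewrite /enorm sqr_sqrtr; last by apply: sumr_ge0 => i _; exact: sqr_ge0.
by apply: eq_bigr => i _; rewrite expr2.
Qed.

(** The identity holds coordinate by coordinate. Its exact last term is the strong convexity of the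
    proximal term, the source of all quadratic growth below. *)
Lemma sqr_enorm_segpt (R : realType) (n : nat) (x y z : 'rV[R]_n) (t : R) :
  enorm (segpt y z t - x) ^+ 2 =
  (1 - t) * enorm (y - x) ^+ 2 + t * enorm (z - x) ^+ 2
  - t * (1 - t) * enorm (z - y) ^+ 2.
Proof.
rewrite !sqr_enormE !mulr_sumr -big_split -sumrB; apply: eq_bigr => i _ /=.
by rewrite !mxE; ring.
Qed.

Lemma sqr_enorm_gt0 (R : realType) (n : nat) (u : 'rV[R]_n) :
  u != 0 -> 0 < enorm u ^+ 2.
Proof.
move=> u0; rewrite lt_def sqr_ge0 andbT; apply: contra u0.
rewrite sqr_enormE psumr_eq0 => [/allP u0|i _]; last exact: sqr_ge0.
apply/eqP/rowP => i; rewrite mxE.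
by apply/eqP; rewrite -sqrf_eq0; apply: u0; rewrite mem_index_enum.
Qed.

Lemma cutval_segpt (R : realType) (n : nat) (c : affine_cut R n)
    (y z : 'rV[R]_n) (t : R) :
  cutval c (segpt y z t) = (1 - t) * cutval c y + t * cutval c z.
Proof.
have -> : cutval c (segpt y z t) =
    (1 - t) * dot c.1 y + t * dot c.1 z + c.2.
  rewrite /cutval /dot !mulr_sumr -big_split; congr (_ + _).
  by apply: eq_bigr => i _; rewrite !mxE /=; ring.
by rewrite /cutval; ring.
Qed.

Lemma convex_function_segpt (R : realType) (n : nat) (g : 'rV[R]_n -> R)
    (y z : 'rV[R]_n) (t : R) :
  convex_function setT g -> 0 <= t <= 1 ->
  g (segpt y z t) <= (1 - t) * g y + t * g z.
Proof.
move=> cg t01.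
have s01 : 0 <= 1 - t <= 1 by lra.
have [s0 s1] := andP s01.
have := cg (Itv01 s0 s1) y z (in_setT _) (in_setT _).
by rewrite convRE /conv /= unstable.onemK.
Qed.

(** * Maxima of finitely many cuts *)

Lemma seq_argmax (R : realDomainType) (T : eqType) (F : T -> R) (s : seq T)
    (a : T) :
  a \in s -> exists2 c, c \in s & forall d, d \in s -> F d <= F c.
Proof.
elim: s a => // b s IHs a _; case: s IHs => [_|e s IHs].
  by exists b; [exact: mem_head|move=> d; rewrite inE => /eqP ->].
have [c cs cmax] := IHs e (mem_head _ _).
have [bc|/ltW cb] := lerP (F b) (F c).
  exists c; first by rewrite inE cs orbT.
  by move=> d; rewrite inE => /predU1P[->//|/cmax].
exists b; first exact: mem_head.
move=> d; rewrite inE => /predU1P[->//|/cmax dc]; exact: le_trans dc cb.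
Qed.

Lemma maxcut_attained (R : realType) (n : nat) (B : set (affine_cut R n))
    (x : 'rV[R]_n) :
  finite_set B -> B !=set0 -> exists2 c, B c & maxcut B x = cutval c x.
Proof.
move=> /finite_seqP[s ->] [a /= sa].
have [c sc cmax] := @seq_argmax _ _ (fun c => cutval c x) _ _ sa.
exists c => //; apply/eqP; rewrite eq_le; apply/andP; split.
  apply: ge_sup; first by exists (cutval a x), a.
  by move=> _ [d sd <-]; exact: cmax.
apply: ub_le_sup; last by exists c.
by exists (cutval c x) => _ [d sd <-]; exact: cmax.
Qed.

Lemma cutval_le_maxcut (R : realType) (n : nat) (B : set (affine_cut R n))
    (c : affine_cut R n) (x : 'rV[R]_n) :
  finite_set B -> B c -> cutval c x <= maxcut B x.
Proof.
move=> fB Bc.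
have /finite_seqP[s Bs] := fB; move: Bc; rewrite Bs /= => sc.
have [a _ amax] := @seq_argmax _ _ (fun c => cutval c x) _ _ sc.
by apply: ub_le_sup; [exists (cutval a x) => _ [d sd <-]; exact: amax|exists c].
Qed.

Lemma composite_segpt (R : realType) (n : nat) (g : 'rV[R]_n -> R)
    (B : set (affine_cut R n)) (y z : 'rV[R]_n) (t : R) :
  convex_function setT g -> finite_set B -> B !=set0 -> 0 <= t <= 1 ->
  composite g B (segpt y z t) <=
    (1 - t) * composite g B y + t * composite g B z.
Proof.
move=> cg fB B0 /[dup] t01 /andP[t0 t1].
have [c Bc cE] := maxcut_attained (segpt y z t) fB B0.
have gt := convex_function_segpt y z cg t01.
have cy := ler_wpM2l (_ : 0 <= 1 - t) (cutval_le_maxcut y fB Bc).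
have cz := ler_wpM2l t0 (cutval_le_maxcut z fB Bc).
rewrite /composite cE cutval_segpt.
by move: gt (cy ltac:(lra)) cz; lra.
Qed.

(** * Growth of the proximal model around its minimizer, with or without inactive cuts *)

Lemma ler_onem_mul (R : realType) (a b d : R) :
  0 < d -> (forall t, 0 < t < d -> (1 - t) * a <= b) -> a <= b.
Proof.
move=> d0 H; apply/ler_addgt0Pr => e e0.
have A0 : 0 < 1 + `|a| by rewrite ltr_pwDl.
(* A stand-in for letting t tend to 0: the first bound keeps t below [d], the second makes the lost
   term [t * a] at most [e]. *)
pose t := Num.min (d / 2) (e / (1 + `|a|)).
have t0 : 0 < t by rewrite /t lt_min !divr_gt0.
have td : t < d by rewrite /t gt_min; apply/orP; left; lra.
have te : t * (1 + `|a|) <= e by rewrite -ler_pdivlMr // /t ge_min lexx orbT.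
have := H t; rewrite t0 td => /(_ isT).
have : t * a <= t * (1 + `|a|).
  by rewrite ler_pM2l // (le_trans (ler_norm a)) // lerDr.
lra.
Qed.

(* Minimality is only assumed on [y, z] near y: this is all that is known of y
   once the cuts inactive at y are dropped from the bundle. *)
Lemma prox_model_growth (R : realType) (n : nat) (g : 'rV[R]_n -> R)
    (B : set (affine_cut R n)) (rho d : R) (x y z : 'rV[R]_n) :
  convex_function setT g -> finite_set B -> B !=set0 -> 0 < d ->
  (forall t, 0 < t < d ->
    prox_model g B rho x y <= prox_model g B rho x (segpt y z t)) ->
  prox_model g B rho x y + rho / 2 * enorm (z - y) ^+ 2
    <= prox_model g B rho x z.
Proof.
move=> cg fB B0 d0 ymin; rewrite -lerBrDl.
apply: (@ler_onem_mul _ _ _ (Num.min d 1)); first by rewrite lt_min d0 ltr01.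
move=> t /andP[t0]; rewrite lt_min => /andP[td t1].
have := ymin t; rewrite t0 td => /(_ isT) yt.
have t01 : 0 <= t <= 1 by rewrite !ltW.
have := composite_segpt y z cg fB B0 t01.
move: yt; rewrite /prox_model sqr_enorm_segpt -/(composite g B _).
rewrite -!/(composite g B _).
set P := composite g B _; set Q := composite g B _; set S := composite g B _.
set u := enorm _ ^+ 2; set v := enorm _ ^+ 2; set w := enorm _ ^+ 2.
move=> H1 H2.
(* Adding [H1] and [H2] cancels [Q] and leaves t times the goal. *)
rewrite -(ler_pM2l t0); nra.
Qed.

(** A strict gap at [y] persists on a short initial piece of the segment, and finitely many cuts
    share one such piece. *)
Lemma inactive_cuts_below (R : realType) (n : nat) (s : seq (affine_cut R n))
    (a : affine_cut R n) (y z : 'rV[R]_n) :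
  exists2 d : R, 0 < d & forall t, 0 < t < d -> forall c, c \in s ->
    cutval c y < cutval a y ->
    cutval c (segpt y z t) <= cutval a (segpt y z t).
Proof.
elim: s => [|b s [d d0 IHs]]; first by exists 1.
have [ba|ab] := ltrP (cutval b y) (cutval a y); last first.
  exists d => // t td c; rewrite inE => /predU1P[->|/IHs]; last exact.
  by rewrite ltNge ab.
pose p := cutval a y - cutval b y.
pose q := cutval b z - cutval a z.
have p0 : 0 < p by rewrite subr_gt0.
have pq0 : 0 < p + `|q| by rewrite ltr_wpDr.
(* With gap [p] at [y] and excess [q] at [z], the order persists while [t * q <= (1 - t) * p]. Using
   [|q|] keeps the denominator positive. *)
exists (Num.min d (p / (p + `|q|))); first by rewrite lt_min d0 divr_gt0.
move=> t /andP[t0]; rewrite lt_min => /andP[td].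
rewrite ltr_pdivlMr // => tp c; rewrite inE => /predU1P[-> _|cs]; last first.
  by apply: IHs; rewrite ?t0.
have : t * q <= t * `|q| by rewrite ler_pM2l // ler_norm.
rewrite !cutval_segpt; rewrite /p /q in tp *; lra.
Qed.

Lemma maxcut_active (R : realType) (n : nat) (B : set (affine_cut R n))
    (y : 'rV[R]_n) :
  finite_set B -> B !=set0 -> maxcut (active B y) y = maxcut B y.
Proof.
move=> fB B0; have [a Ba aE] := maxcut_attained y fB B0.
have fA : finite_set (active B y) by apply: sub_finite_set fB => c [].
have Aa : active B y a by split.
have [c [Bc cE] ->] := maxcut_attained y fA (ex_intro _ a Aa).
exact: cE.
Qed.

(** Near [y] on the segment the active cuts already realize the full maximum, so [y] is still a
    local minimizer there once the others are dropped; convexity turns this into growth at any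
    distance. *)
Lemma prox_model_active_growth (R : realType) (n : nat) (g : 'rV[R]_n -> R)
    (B : set (affine_cut R n)) (rho : R) (x y z : 'rV[R]_n) :
  convex_function setT g -> finite_set B -> B !=set0 ->
  minimizer (prox_model g B rho x) y ->
  prox_model g B rho x y + rho / 2 * enorm (z - y) ^+ 2
    <= prox_model g (active B y) rho x z.
Proof.
move=> cg fB B0 ymin; have [a Ba aE] := maxcut_attained y fB B0.
have fA : finite_set (active B y) by apply: sub_finite_set fB => c [].
have Aa : active B y a by split.
have A0 : active B y !=set0 by exists a.
have yA : prox_model g (active B y) rho x y = prox_model g B rho x y.
  by rewrite /prox_model maxcut_active.
have /finite_seqP[s Bs] := fB.
have [d d0 dP] := inactive_cuts_below s a y z.
rewrite -yA; apply: (prox_model_growth cg fA A0 d0) => t td.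
rewrite yA (le_trans (ymin (segpt y z t))) // /prox_model lerD2r lerD2l.
have [c Bc ->] := maxcut_attained (segpt y z t) fB B0.
have cy := cutval_le_maxcut y fB Bc.
have [ca|ca] := ltrP (cutval c y) (cutval a y); last first.
  apply: cutval_le_maxcut => //; split => //.
  by apply/eqP; rewrite eq_le cy aE ca.
apply: le_trans (cutval_le_maxcut _ fA Aa).
by apply: dP => //; move: Bc; rewrite Bs.
Qed.

Lemma maxcut_le (R : realType) (n : nat) (A B : set (affine_cut R n))
    (x : 'rV[R]_n) :
  finite_set B -> A `<=` B -> A !=set0 -> maxcut A x <= maxcut B x.
Proof.
move=> fB AB A0.
have [c Ac ->] := maxcut_attained x (sub_finite_set AB fB) A0.
by apply: cutval_le_maxcut => //; exact: AB.
Qed.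

(** * Null steps *)

Lemma run_bundle (R : realType) (n : nat) (g : 'rV[R]_n -> R)
    (V : set (affine_cut R n)) (rho eps : R) (x0 : 'rV[R]_n)
    (V0 : set (affine_cut R n)) (x y : nat -> 'rV[R]_n)
    (B : nat -> set (affine_cut R n)) (c : nat -> affine_cut R n) (k : nat) :
  V0 `<=` V -> V0 !=set0 -> MPBFA_run g V rho eps x0 V0 x y B c ->
  B k `<=` V /\ B k !=set0.
Proof.
move=> V0V V00 run; elim: k => [|k [BV B0]]; first by rewrite (run_B0 run).
rewrite (run_B run); split; last by exists (c k.+1); right.
by move=> d [[/BV//]|->]; have [] := run_c run k.
Qed.

(* The active cuts determine the minimum of the prox model, so dropping the
   others costs nothing, while the new cut is violated at the minimizer. *)
Lemma null_step_prox_lt (R : realType) (n : nat) (g : 'rV[R]_n -> R)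
    (V : set (affine_cut R n)) (rho eps : R) (x0 : 'rV[R]_n)
    (V0 : set (affine_cut R n)) (x y : nat -> 'rV[R]_n)
    (B : nat -> set (affine_cut R n)) (c : nat -> affine_cut R n) (k : nat) :
  convex_function setT g -> finite_set V -> 0 < rho -> 0 < eps ->
  V0 `<=` V -> V0 !=set0 -> MPBFA_run g V rho eps x0 V0 x y B c ->
  eps / 2 < maxcut V (y k.+1) - maxcut (B k) (y k.+1) ->
  prox_model g (B k) rho (x k) (y k.+1) <
    prox_model g (B k.+1) rho (x k.+1) (y k.+2).
Proof.
move=> cg fV rho0 eps0 V0V V00 run null.
have [BV B0] := run_bundle k V0V V00 run.
have fB := sub_finite_set BV fV.
have [BV' _] := run_bundle k.+1 V0V V00 run.
have fB' := sub_finite_set BV' fV.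
rewrite (run_null run null).
(* If the minimizer stays put, the new cut lifts the model there by more than [eps / 2]; if it
   moves, the quadratic growth term is positive. *)
have [->|yy] := eqVneq (y k.+2) (y k.+1).
  rewrite /prox_model ltrD2r ltrD2l.
  have [d Vd dE] :=
    maxcut_attained (y k.+1) fV (ex_intro _ _ (run_c run k).1).
  have cB : B k.+1 (c k.+1) by rewrite (run_B run); right.
  have := cutval_le_maxcut (y k.+1) fB' cB.
  have := (run_c run k).2 d Vd.
  lra.
have growth := prox_model_active_growth (y k.+2) cg fB B0 (run_y run k).
have [a Ba aE] := maxcut_attained (y k.+1) fB B0.
have A0 : active (B k) (y k.+1) !=set0 by exists a; split.
have AB : active (B k) (y k.+1) `<=` B k.+1.
  by rewrite (run_B run) => d; left.
apply: lt_le_trans (_ : prox_model g (active (B k) (y k.+1)) rho (x k) (y k.+2)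
  <= _).
  apply: lt_le_trans growth; rewrite ltrDl mulr_gt0 ?divr_gt0 //.
  by rewrite sqr_enorm_gt0 // subr_eq0.
by rewrite /prox_model lerD2r lerD2l maxcut_le.
Qed.

(* During a streak of null steps the minimum of the prox model increases, so
   no bundle, that is no subset of V, occurs twice. *)
Lemma serious_step_exists (R : realType) (n : nat) (g : 'rV[R]_n -> R)
    (s : seq (affine_cut R n)) (rho eps : R) (x0 : 'rV[R]_n)
    (V0 : set (affine_cut R n)) (x y : nat -> 'rV[R]_n)
    (B : nat -> set (affine_cut R n)) (c : nat -> affine_cut R n) (k : nat) :
  convex_function setT g -> 0 < rho -> 0 < eps ->
  V0 `<=` [set` s] -> V0 !=set0 ->
  MPBFA_run g [set` s] rho eps x0 V0 x y B c ->
  exists2 i : nat, (i <= 2 ^ size s)%N &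
    maxcut [set` s] (y (k + i).+1) - maxcut (B (k + i)%N) (y (k + i).+1)
      <= eps / 2.
Proof.
move=> cg rho0 eps0 V0V V00 run; have fV := finite_seq s.
apply: contrapT => noserious.
have null i : (i <= 2 ^ size s)%N -> eps / 2 <
    maxcut [set` s] (y (k + i).+1) - maxcut (B (k + i)%N) (y (k + i).+1).
  by move=> iN; rewrite ltNge; apply/negP => Hi; apply: noserious; exists i.
have xE i : (i <= 2 ^ size s)%N -> x (k + i)%N = x k.
  elim: i => [|i IHi] iN; first by rewrite addn0.
  by rewrite addnS (run_null run (null _ (ltnW iN))) IHi // ltnW.
pose m l := prox_model g (B l) rho (x l) (y l.+1).
have m_lt i j : (i < j)%N -> (j <= 2 ^ size s)%N ->
    m (k + i)%N < m (k + j)%N.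
  elim: j => // j IHj; rewrite ltnS leq_eqVlt => /predU1P[->|ij] jN.
    rewrite addnS.
    exact: null_step_prox_lt cg fV rho0 eps0 V0V V00 run (null _ (ltnW jN)).
  apply: lt_trans (IHj ij (ltnW jN)) _; rewrite addnS.
  exact: null_step_prox_lt cg fV rho0 eps0 V0V V00 run (null _ (ltnW jN)).
have B_neq i j : (i < j)%N -> (j <= 2 ^ size s)%N ->
    B (k + i)%N <> B (k + j)%N.
  (* Equal bundles with the same prox center have the same minimum, against [m_lt]. *)
  move=> ij jN BE; have := m_lt _ _ ij jN; apply/negP; rewrite -leNgt /m -BE.
  rewrite !xE ?(leq_trans (ltnW ij)) //.
  by have := run_y run (k + j); rewrite -BE xE.
(* Pigeonhole: [2 ^ size s + 1] bundles, encoded by membership of the entries of [s], have only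
   [2 ^ size s] possible codes. *)
pose code (i : 'I_(2 ^ size s).+1) : {ffun 'I_(size s) -> bool} :=
  [ffun l => `[< B (k + i)%N (tnth (in_tuple s) l) >]].
have code_inj : injective code.
  have codeB (i j : 'I_(2 ^ size s).+1) : code i = code j ->
      B (k + i)%N = B (k + j)%N.
    move=> /ffunP ij; apply/seteqP.
    have sub (u v : 'I_(2 ^ size s).+1) :
        (forall l, code u l = code v l) -> B (k + u)%N `<=` B (k + v)%N.
      move=> uv d Bd.
      have [BV _] := run_bundle (k + u) V0V V00 run.
      have /tnthP[l dE] : d \in in_tuple s by exact: BV Bd.
      have := uv l; rewrite !ffunE -dE asboolT // => /esym/asboolP.
      exact.
    by split; apply: sub => l; rewrite ij.
  move=> i j /codeB BE; apply/val_inj/eqP; case: ltngtP => //= ij.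
  - by case: (B_neq i j ij _ BE); rewrite -ltnS.
  - by case: (B_neq j i ij _ (esym BE)); rewrite -ltnS.
by have := leq_card _ code_inj;
  rewrite card_ord card_ffun card_bool card_ord ltnn.
Qed.

(** * Serious steps and the iteration count *)

Lemma serious_step_descent (R : realType) (n : nat) (g : 'rV[R]_n -> R)
    (V : set (affine_cut R n)) (rho eps : R) (x0 xs : 'rV[R]_n)
    (V0 : set (affine_cut R n)) (x y : nat -> 'rV[R]_n)
    (B : nat -> set (affine_cut R n)) (c : nat -> affine_cut R n) (k : nat) :
  convex_function setT g -> finite_set V -> 0 < rho ->
  V0 `<=` V -> V0 !=set0 -> MPBFA_run g V rho eps x0 V0 x y B c ->
  maxcut V (y k.+1) - maxcut (B k) (y k.+1) <= eps / 2 ->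
  ~ eps_optimal (composite g V) xs eps (x k.+1) ->
  enorm (xs - x k.+1) ^+ 2 + eps / rho <= enorm (xs - x k) ^+ 2.
Proof.
move=> cg fV rho0 V0V V00 run serious /negP.
rewrite /eps_optimal -ltNge (run_serious run serious) => nopt.
have [BV B0] := run_bundle k V0V V00 run.
have fB := sub_finite_set BV fV.
(* The composite part of the model is at most h(xs) at [xs], and at the new point at least h -
   eps/2, hence above h(xs) + eps/2. This gap of eps/2, scaled by 2/rho, is the gain eps/rho. *)
have := prox_model_growth (z := xs) cg fB B0 ltr01
  (fun t _ => run_y run k (segpt _ _ t)).
have Bxs := maxcut_le xs fV BV B0.
have yx0 : 0 <= rho / 2 * enorm (y k.+1 - x k) ^+ 2.
  by rewrite mulr_ge0 ?sqr_ge0 // divr_ge0 // ltW.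
rewrite /prox_model; rewrite /composite in nopt => growth.
rewrite -lerBrDl ler_pdivrMr //.
nra.
Qed.

(** Cut the run into blocks of [N.+1] iterations. Each contains a serious step, so while the target
    is missed each block lowers [D] by at least [eps / rho], and [D] cannot become negative. *)
Lemma MPBFA_iterations (R : realType) (n : nat) (g : 'rV[R]_n -> R)
    (s : seq (affine_cut R n)) (rho eps : R) (x0 xs : 'rV[R]_n)
    (V0 : set (affine_cut R n)) (x y : nat -> 'rV[R]_n)
    (B : nat -> set (affine_cut R n)) (c : nat -> affine_cut R n) :
  convex_function setT g -> 0 < rho -> 0 < eps ->
  V0 `<=` [set` s] -> V0 !=set0 ->
  MPBFA_run g [set` s] rho eps x0 V0 x y B c ->
  exists2 k : nat,
    k%:R <= (2 ^ size s).+1%:R * (rho / eps * enorm (xs - x0) ^+ 2 + 1) &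
    eps_optimal (composite g [set` s]) xs eps (x k).
Proof.
move=> cg rho0 eps0 V0V V00 run; have fV := finite_seq s.
set N := (2 ^ size s)%N; pose D k := enorm (xs - x k) ^+ 2.
pose q := rho / eps * enorm (xs - x0) ^+ 2.
have q0 : 0 <= q by rewrite mulr_ge0 ?sqr_ge0 // divr_ge0 // ltW.
apply: contrapT => nok.
(* The least integer above [q]: [J] blocks would use up more than [D 0], yet [J <= q + 1]. *)
pose J := (Num.trunc q).+1.
have /andP[qJ Jq] := truncn_itv q0.
have nopt k : (k <= J * N.+1)%N ->
    ~ eps_optimal (composite g [set` s]) xs eps (x k).
  move=> kJ kopt; apply: nok; exists k => //.
  rewrite -/q (le_trans (_ : _ <= (J * N.+1)%:R)) ?ler_nat //.
  by rewrite mulnC natrM ler_pM2l ?ltr0n // /J -natr1 lerD2r.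
have eps_rho : 0 < eps / rho by rewrite divr_gt0.
have Dstep k : (k < J * N.+1)%N -> D k.+1 <= D k.
  move=> kJ; rewrite /D.
  have [ser|nul] := lerP
    (maxcut [set` s] (y k.+1) - maxcut (B k) (y k.+1)) (eps / 2).
    have := serious_step_descent cg fV rho0 V0V V00 run ser (nopt _ kJ).
    lra.
  by rewrite (run_null run nul).
have Dle k i : (k + i <= J * N.+1)%N -> D (k + i)%N <= D k.
  elim: i => [|i IHi]; rewrite ?addn0 // addnS => kiJ.
  exact: le_trans (Dstep _ kiJ) (IHi (ltnW kiJ)).
have Dj j : (j <= J)%N -> D (j * N.+1)%N + j%:R * (eps / rho) <= D 0%N.
  elim: j => [|j IHj] jJ; first by rewrite mul0n mul0r addr0.
  have [i iN ser] :=
    serious_step_exists (j * N.+1) cg rho0 eps0 V0V V00 run.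
  have jNJ : (j.+1 * N.+1 <= J * N.+1)%N by rewrite leq_mul2r jJ orbT.
  have jiJ : (j * N.+1 + i < j.+1 * N.+1)%N.
    by rewrite mulSn addnC ltn_add2r ltnS.
  have desc := serious_step_descent cg fV rho0 V0V V00 run ser
    (nopt _ (leq_trans jiJ jNJ)).
  (* [D] does not increase before or after the chosen serious step, so the gain of that step
     survives to the end of the block. *)
  have D1 := Dle (j * N.+1)%N i (ltnW (leq_trans jiJ jNJ)).
  have := Dle (j * N.+1 + i).+1 (j.+1 * N.+1 - (j * N.+1 + i).+1)%N.
  rewrite subnKC // => /(_ jNJ) D2.
  have := IHj (ltnW jJ); rewrite -natr1 mulrDl mul1r.
  rewrite /D in desc D1 D2 *; lra.
have := Dj J (leqnn J); apply/negP; rewrite -ltNge ltr_wpDl ?sqr_ge0 //.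
rewrite mulrA ltr_pdivlMr // -ltr_pdivrMr //.
by rewrite /D (run_x0 run) -mulrA mulrC.
Qed.

(** * Comparison with the rate *)

Lemma prox_scaleE (R : realType) (eps : R) :
  0 < eps < 1 -> prox_scale eps = eps * rate eps.
Proof.
move=> /andP[e0 e1].
(* Nonnegativity of the logarithm lets the 1/9 power of its square become its 2/9 power. *)
have l0 : 0 <= ln eps^-1 by rewrite ln_ge0 // invf_ge1 // ltW.
rewrite /prox_scale /rate powRM ?sqr_ge0 ?(ltW e0) // mulrA; congr (_ * _).
  rewrite -[X in _ = X * _](powRr1 (ltW e0)) -powRD ?(gt_eqF e0) ?implybT //.
  by congr (_ `^ _); field.
by rewrite -powR_mulrn // -powRrM; congr (_ `^ _); field.
Qed.

(** Below 1/e the logarithm is at least 1, so both factors are. This absorbs the additive 1 of the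
    iteration bound. *)
Lemma rate_ge1 (R : realType) (eps : R) :
  0 < eps < expR (- 1) -> 1 <= rate eps.
Proof.
move=> /andP[e0 e1].
have l1 : 1 <= ln eps^-1.
  by rewrite -[X in X <= _]expRK ler_ln ?posrE ?invr_gt0 ?expR_gt0 //
    -[X in X <= _]invrK lef_pV2 ?posrE ?invr_gt0 ?expR_gt0 // -expRN ltW.
have e1' : eps <= 1.
  by rewrite (le_trans (ltW e1)) // -[leRHS]expR0 ler_expR lerN10.
rewrite /rate -[X in X <= _]mulr1 ler_pM //.
  by rewrite -[X in X <= _](powRr0 eps) ger_powR ?e0 //; lra.
by rewrite -[X in X <= _](powRr0 (ln eps^-1)) ler_powR //; lra.
Qed.

Theorem lemma4p1 (R : realType) (n : nat) (g : 'rV[R]_n -> R)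
    (V : set (affine_cut R n)) (x0 xs : 'rV[R]_n) (rho : R -> R) :
  convex_function setT g ->
  smooth g ->
  finite_set V ->
  V !=set0 ->
  minimizer (composite g V) xs ->
  (forall eps, 0 < eps -> 0 < rho eps) ->
  (exists K : R, \forall eps \near 0^'+, rho eps <= K * prox_scale eps) ->
  exists2 C : R, 0 < C &
    \forall eps \near 0^'+,
      forall (V0 : set (affine_cut R n)) (x y : nat -> 'rV[R]_n)
             (B : nat -> set (affine_cut R n)) (c : nat -> affine_cut R n),
        V0 `<=` V -> V0 !=set0 ->
        MPBFA_run g V (rho eps) eps x0 V0 x y B c ->
        exists2 k : nat, k%:R <= C * rate eps &
          eps_optimal (composite g V) xs eps (x k).
Proof.
move=> cg _ /finite_seqP[s ->] _ _ rho0 [K rhoK].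
pose D := enorm (xs - x0) ^+ 2.
have D0 : 0 <= D by rewrite sqr_ge0.
have KD0 : 0 <= `|K| * D by rewrite mulr_ge0.
(* Block length times a bound on the number of blocks per unit of [rate eps]; [|K|] because [K] may
   be negative. *)
exists ((2 ^ size s).+1%:R * (`|K| * D + 1)).
  by rewrite mulr_gt0 ?ltr0n // ltr_wpDl.
near=> eps => V0 x y B c V0V V00 run.
have eps0 : 0 < eps by near: eps; exact: nbhs_right_gt.
have epse : eps < expR (- 1).
  by near: eps; apply: nbhs_right_lt; exact: expR_gt0.
have eps1 : eps < 1.
  by rewrite (lt_trans epse) // -[ltRHS]expR0 ltr_expR ltrN10.
have rate1 : 1 <= rate eps by rewrite rate_ge1 ?eps0.
have [k kle kopt] := MPBFA_iterations xs cg (rho0 _ eps0) eps0 V0V V00 run.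
exists k => //; apply: le_trans kle _; rewrite -[leRHS]mulrA ler_pM2l ?ltr0n //.
rewrite mulrDl mul1r lerD // [leRHS]mulrAC ler_wpM2r // ler_pdivrMr //.
have : rho eps <= K * prox_scale eps by near: eps.
move=> /le_trans; apply; rewrite prox_scaleE ?eps0 // mulrA mulrAC.
by rewrite !ler_wpM2r ?ler_norm ?(ltW eps0) ?(le_trans ler01 rate1).
Unshelve. all: by end_near.
Qed.
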